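(* Let $(T, \dashv, \vdash, \cdot, \varepsilon, \alpha)$ be a Hom-tridendriform color algebra. For $x, y\in\mathcal{H}(T)$ set $$x\circ y=x\vdash y-y\dashv x\quad\text{and}\quad [x, y]=x\cdot y-\varepsilon(x, y)\,y\cdot x.$$ Then $T$, with the bracket $[-,-]$, the product $\circ$, the bicharacter $\varepsilon$ and the twisting map $\alpha$, is a Hom-post-Lie color algebra.
   Context: All vector spaces are over a field $\mathbb{K}$ of characteristic different from $2$, $G$ is an abelian group, and a linear map or bilinear map between $G$-graded spaces is called even if it preserves degree. $\mathcal{H}(A)$ denotes the set of homogeneous elements of a $G$-graded space $A$. A bicharacter on $G$ is a map $\varepsilon:G\times G\to\mathbb{K}^*$ with $\varepsilon(a,b)\varepsilon(b,a)=1$, $\varepsilon(a,b+c)=\varepsilon(a,b)\varepsilon(a,c)$, $\varepsilon(a+b,c)=\varepsilon(a,c)\varepsilon(b,c)$ for all $a,b,c\in G$. For homogeneous $x,y$ of degrees $a,b$ one writes $\varepsilon(x,y):=\varepsilon(a,b)$. A Hom-tridendriform color algebra $(T,\dashv,\vdash,\cdot,\varepsilon,\alpha)$ is a $G$-graded linear space $T$ with three even bilinear maps $\dashv,\vdash,\cdot$, a bicharacter $\varepsilon$ and an even linear map $\alpha:T\to T$ such that for all $x,y,z\in\mathcal{H}(T)$: $(x\dashv y)\dashv\alpha(z)=\alpha(x)\dashv(y\dashv z+\varepsilon(z, y)\,y\vdash z+\varepsilon(z, y)\,y\cdot z)$; $(x\vdash y)\dashv\alpha(z)=\varepsilon(z,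 x)\,\alpha(x)\vdash(y\dashv z)$; $\alpha(x)\vdash(y\vdash z)=(\varepsilon(x, y)\,x\dashv y+x\vdash y+x\cdot y)\vdash\alpha(z)$; $(x\dashv y)\cdot\alpha(z)=\varepsilon(y, x)\,\alpha(x)\cdot(y\vdash z)$; $(x\vdash y)\cdot\alpha(z)=\alpha(x)\vdash(y\cdot z)$; $(x\cdot y)\dashv\alpha(z)=\varepsilon(z, x)\,\alpha(x)\cdot(y\dashv z)$; $(x\cdot y)\cdot\alpha(z)=\alpha(x)\cdot(y\cdot z)$. A Hom-post-Lie color algebra $(L,[-,-],\cdot,\varepsilon,\alpha)$ is a $G$-graded linear space $L$ with a bicharacter $\varepsilon$, an even linear map $\alpha:L\to L$ and even bilinear maps $[-,-]$ and $\cdot$ such that for all $x,y,z\in\mathcal{H}(L)$: $[x,y]=-\varepsilon(x,y)[y,x]$; $\varepsilon(z, x)[\alpha(x), [y, z]] + \varepsilon(x, y)[\alpha(y), [z, x]]+\varepsilon(y, z)[\alpha(z), [x, y]]=0$; $\alpha(z)\cdot [x, y]-[z\cdot x, \alpha(y)]-\varepsilon(z, x)[\alpha(x), z\cdot y]=0$; $\alpha(z)\cdot(y\cdot x)-\varepsilon(z, y)\alpha(y)\cdot(z\cdot x)+\varepsilon(z, y)(y\cdot z)\cdot\alpha(x)-(z\cdot y)\cdot\alpha(x)+\varepsilon(z, y)[y, z]\cdot\alpha(x)=0$. *)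

(* Defs.v *)
From HB Require Import structures.
From mathcomp Require Import all_boot all_order all_algebra.
From mathcomp Require Import boolp classical_sets functions cardinality fsbigop.
Set Implicit Arguments.
Unset Strict Implicit.
Unset Printing Implicit Defensive.
Import GRing.Theory.
Local Open Scope classical_set_scope.
Local Open Scope ring_scope.

Section Grading.
Variables (K : fieldType) (G : zmodType) (T : lmodType K).
Implicit Types (V : G -> {pred T}) (x : T).

Definition is_decomposition V x (f : G -> T) : Prop :=
  [/\ forall a, f a \in V a,
      finite_set [set a | f a != 0] &
      x = \sum_(a \in [set: G]) f a].

(* [T] is the direct sum of the subspaces [V a] *)
Definition is_grading V : Prop :=
  (forall a, submod_closed (V a)) /\
  (forall x, exists! f : G -> T, is_decomposition V x f).

(* The component of degree [a] of [x]; the default value [0] is irrelevant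
   when [V] is a grading. *)
Definition hcomp V x (a : G) : T :=
  xget 0 [set y | exists2 f, is_decomposition V x f & y = f a].

Definition even_map V (f : T -> T) : Prop :=
  forall a x, x \in V a -> f x \in V a.

Definition even_map2 V (m : T -> T -> T) : Prop :=
  forall a b x y, x \in V a -> y \in V b -> m x y \in V (a + b).

Definition even_linear V (f : T -> T) : Prop := linear f /\ even_map V f.

Definition even_bilinear V (m : T -> T -> T) : Prop :=
  bilinear_for *:%R *:%R m /\ even_map2 V m.

Record is_bicharacter (eps : G -> G -> K) : Prop := {
  bichar_neq0 : forall a b, eps a b != 0;
  bichar_skew : forall a b, eps a b * eps b a = 1;
  bicharDr : forall a b c, eps a (b + c) = eps a b * eps a c;
  bicharDl : forall a b c, eps (a + b) c = eps a c * eps b c }.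

End Grading.

(* In both structures below, an identity for all homogeneous [x], [y], [z] is
   quantified over degrees [a], [b], [c] and elements of [V a], [V b], [V c],
   so that [eps(x, y)] is [eps a b]; for a zero element, whose degree is not
   determined, the identities hold trivially for every choice of degree. *)

Section HomTridendriformColor.
Variables (K : fieldType) (G : zmodType) (T : lmodType K).
Variables (V : G -> {pred T}) (lt rt dt : T -> T -> T).
Variables (eps : G -> G -> K) (alpha : T -> T).
Local Notation "x ⊣ y" := (lt x y) (at level 40, left associativity).
Local Notation "x ⊢ y" := (rt x y) (at level 40, left associativity).
Local Notation "x ⋅ y" := (dt x y) (at level 40, left associativity).

Record is_hom_tridendriform_color : Prop := {
  htd_grading : is_grading V;
  htd_lt : even_bilinear V lt;
  htd_rt : even_bilinear V rt;
  htd_dt : even_bilinear V dt;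
  htd_eps : is_bicharacter eps;
  htd_alpha : even_linear V alpha;
  htd_lt_lt : forall a b c x y z, x \in V a -> y \in V b -> z \in V c ->
    (x ⊣ y) ⊣ alpha z =
      alpha x ⊣ (y ⊣ z + eps c b *: (y ⊢ z) + eps c b *: (y ⋅ z));
  htd_rt_lt : forall a b c x y z, x \in V a -> y \in V b -> z \in V c ->
    (x ⊢ y) ⊣ alpha z = eps c a *: (alpha x ⊢ (y ⊣ z));
  htd_rt_rt : forall a b c x y z, x \in V a -> y \in V b -> z \in V c ->
    alpha x ⊢ (y ⊢ z) =
      (eps a b *: (x ⊣ y) + x ⊢ y + x ⋅ y) ⊢ alpha z;
  htd_lt_dt : forall a b c x y z, x \in V a -> y \in V b -> z \in V c ->
    (x ⊣ y) ⋅ alpha z = eps b a *: (alpha x ⋅ (y ⊢ z));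
  htd_rt_dt : forall a b c x y z, x \in V a -> y \in V b -> z \in V c ->
    (x ⊢ y) ⋅ alpha z = alpha x ⊢ (y ⋅ z);
  htd_dt_lt : forall a b c x y z, x \in V a -> y \in V b -> z \in V c ->
    (x ⋅ y) ⊣ alpha z = eps c a *: (alpha x ⋅ (y ⊣ z));
  htd_dt_dt : forall a b c x y z, x \in V a -> y \in V b -> z \in V c ->
    (x ⋅ y) ⋅ alpha z = alpha x ⋅ (y ⋅ z) }.

End HomTridendriformColor.

Section HomPostLieColor.
Variables (K : fieldType) (G : zmodType) (L : lmodType K).
Variables (V : G -> {pred L}) (br dt : L -> L -> L).
Variables (eps : G -> G -> K) (alpha : L -> L).
Local Notation "⟦ x , y ⟧" := (br x y) (at level 0, x, y at level 99).
Local Notation "x ⋅ y" := (dt x y) (at level 40, left associativity).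

Record is_hom_post_lie_color : Prop := {
  hpl_grading : is_grading V;
  hpl_eps : is_bicharacter eps;
  hpl_alpha : even_linear V alpha;
  hpl_br : even_bilinear V br;
  hpl_dt : even_bilinear V dt;
  hpl_skew : forall a b x y, x \in V a -> y \in V b ->
    ⟦x, y⟧ = - (eps a b *: ⟦y, x⟧);
  hpl_jacobi : forall a b c x y z, x \in V a -> y \in V b -> z \in V c ->
    eps c a *: ⟦alpha x, ⟦y, z⟧⟧ + eps a b *: ⟦alpha y, ⟦z, x⟧⟧
      + eps b c *: ⟦alpha z, ⟦x, y⟧⟧ = 0;
  hpl_derivation : forall a b c x y z, x \in V a -> y \in V b -> z \in V c ->
    alpha z ⋅ ⟦x, y⟧ - ⟦z ⋅ x, alpha y⟧ - eps c a *: ⟦alpha x, z ⋅ y⟧ = 0;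
  hpl_post_lie : forall a b c x y z, x \in V a -> y \in V b -> z \in V c ->
    alpha z ⋅ (y ⋅ x) - eps c b *: (alpha y ⋅ (z ⋅ x))
      + eps c b *: ((y ⋅ z) ⋅ alpha x) - (z ⋅ y) ⋅ alpha x
      + eps c b *: (⟦y, z⟧ ⋅ alpha x) = 0 }.

End HomPostLieColor.

Section Commutator.
Variables (K : fieldType) (G : zmodType) (T : lmodType K).
Implicit Types (V : G -> {pred T}) (eps : G -> G -> K) (m : T -> T -> T).

(* The bilinear extension to all of [T] of the map given on homogeneous [x]
   and [y] by [m x y - eps(x, y) m y x]; see [color_commutatorE]. *)
Definition color_commutator V eps m (x y : T) : T :=
  \sum_(a \in [set: G]) \sum_(b \in [set: G])
    (m (hcomp V x a) (hcomp V y b)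
       - eps a b *: m (hcomp V y b) (hcomp V x a)).

Lemma sum_delta (F : G -> T) a :
  (forall b, b != a -> F b = 0) -> \sum_(b \in [set: G]) F b = F a.
Proof.
move=> F0; rewrite -[RHS](@fsbig_set1 _ 0 +%R); apply/esym/fsbig_widen => //.
by move=> b [_ /= /eqP ba]; exact: F0.
Qed.

Lemma hcomp_homog V a x : is_grading V -> x \in V a ->
  forall b, hcomp V x b = if b == a then x else 0.
Proof.
move=> [Vsub Vdec] xa b.
pose d c := if c == a then x else 0.
have dP : is_decomposition V x d.
  split => [c||].
  - by rewrite /d; case: eqP => [->//|_]; case: (Vsub c).
  - apply: (sub_finite_set (B := [set a])); last exact: finite_set1.
    by move=> c /=; rewrite /d; case: (c =P a) => // _; rewrite eqxx.
  - rewrite (@sum_delta _ a) /d ?eqxx// => c /negbTE ->//.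
have [f [_ funiq]] := Vdec x.
apply: xget_unique => [|_ [g /funiq gE ->]]; first by exists d.
by rewrite -gE (funiq _ dP).
Qed.

Lemma color_commutatorE V eps m a b x y :
  is_grading V -> bilinear_for *:%R *:%R m -> x \in V a -> y \in V b ->
  color_commutator V eps m x y = m x y - eps a b *: m y x.
Proof.
move=> gV [mr ml] xa yb; rewrite /color_commutator.
have m0 u : m 0 u = 0.
  by have := mr u (- 1) 0 0; rewrite /= scaler0 addr0 scaleN1r addNr.
have m0r u : m u 0 = 0.
  by have := ml u (- 1) 0 0; rewrite /= scaler0 addr0 scaleN1r addNr.
rewrite (@sum_delta _ a) => [|c /negbTE ca].
  rewrite (@sum_delta _ b) => [|c /negbTE cb].
    by rewrite !(hcomp_homog gV xa) !(hcomp_homog gV yb) !eqxx.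
  by rewrite (hcomp_homog gV yb) cb m0 m0r scaler0 subr0.
rewrite (@sum_delta _ b) => [|d _];
by rewrite (hcomp_homog gV xa) ca m0 m0r scaler0 subr0.
Qed.

End Commutator.

(* Main.v *)
(** Put [x ⊣' y = eps(x, y) x ⊣ y].  The axioms then become those of an
    uncoloured Hom-tridendriform algebra, so [x ⋆ y = x ⊣' y + x ⊢ y + x ⋅ y]
    satisfies [alpha x ⊢ (y ⊢ z) = (x ⋆ y) ⊢ alpha z] and
    [(x ⊣ y) ⊣ alpha z = eps(z, y) alpha x ⊣ (y ⋆ z)].  Since the left and right
    actions commute, the colour commutator of the operators [alpha z ∘ (y ∘ -)]
    and [alpha y ∘ (z ∘ -)] is the action of
    [z ⋆ y - eps(z, y) y ⋆ z = z ∘ y - eps(z, y) y ∘ z + [z, y]], which is the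
    post-Lie identity.  The remaining axioms say that the colour commutator of
    a Hom-associative product is a Hom-Lie bracket, and that [alpha z ∘ -] is a
    twisted derivation of [⋅], hence of its commutator. *)
Require Import Defs.
From HB Require Import structures.
From mathcomp Require Import all_boot all_order all_algebra finmap.
From mathcomp Require Import boolp classical_sets functions cardinality fsbigop.
Import GRing.Theory.
Local Open Scope ring_scope.

(* Closes an identity [t1 + ... + tn = 0] of a zmodule whose terms cancel in
   pairs, by moving the opposite of the last term next to it. *)
Ltac zmod_cancel :=
  apply: (etrans (esym (add0r _)));
  rewrite ?opprD ?opprB ?opprK ?addrA;
  repeat match goal with
  | |- ?s - ?t = 0 => rewrite !(addrAC _ t) subrK
  | |- ?s + ?t = 0 => rewrite !(addrAC _ (- t)) addrK
  end; reflexivity.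

(** * Bilinear maps as bundled structures *)

Section Bilinear.
Context {K : fieldType} {T : lmodType K}.

(** The products are given as bare functions; bundling them makes the generic linearity rewrites
    available. *)
Lemma bilinear_pack (m : T -> T -> T) : bilinear_for *:%R *:%R m ->
  exists f : {bilinear T -> T -> T}, m = f.
Proof.
move=> mP.
pose B := bilinear_isBilinear.Build K T T T *:%R *:%R m mP.
by exists (HB.pack_for {bilinear T -> T -> T} m B).
Qed.

(** At [rt] and [lt] this unfolds to the product [∘] of the theorem. *)
Definition flip_sub (f g : T -> T -> T) (x y : T) : T := f x y - g y x.

Lemma flip_sub_bilinear (f g : {bilinear T -> T -> T}) :
  bilinear_for *:%R *:%R (flip_sub f g).
Proof.
split=> u c x y; rewrite /flip_sub !(linearPl, linearPr) /=;
  by rewrite scalerBr opprD addrACA.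
Qed.

End Bilinear.

(** * Homogeneous components and the colour commutator *)

Section Grading.
Context {K : fieldType} {G : zmodType} {T : lmodType K} (V : G -> {pred T}).
Hypothesis gV : is_grading V.
Local Open Scope classical_set_scope.

Lemma gradingP a c x y : x \in V a -> y \in V a -> c *: x + y \in V a.
Proof. by move=> Vx Vy; have [_ ->] := gV.1 a. Qed.

Lemma gradingD a x y : x \in V a -> y \in V a -> x + y \in V a.
Proof. by have := gradingP a 1 x y; rewrite scale1r. Qed.

Lemma gradingZ a c x : x \in V a -> c *: x \in V a.
Proof. by move=> Vx; rewrite -[_ *: _]addr0; apply: gradingP; case: (gV.1 a). Qed.

Lemma gradingB a x y : x \in V a -> y \in V a -> x - y \in V a.
Proof. by move=> Vx Vy; rewrite -scaleN1r; exact/gradingD/gradingZ. Qed.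

Lemma fsumE {A : set G} (F : G -> T) : finite_set A ->
  (forall a, ~ A a -> F a = 0) ->
  \sum_(a \in [set: G]) F a = \sum_(a <- fset_set A) F a.
Proof.
move=> finA F0; rewrite -fsbig_finite//; apply/esym/fsbig_widen => //.
by move=> a [_ /F0].
Qed.

Lemma hcomp_decomposition x : is_decomposition V x (hcomp V x).
Proof.
have [f [fP f_uniq]] := gV.2 x.
suff -> : hcomp V x = f by [].
apply/funext => a; apply: xget_unique; first by exists f.
by move=> _ [g /f_uniq-> ->].
Qed.

(** By uniqueness of decompositions it suffices that the combined components decompose [c *: x + y];
    their support lies in the union of two finite supports. *)
Lemma hcompP c x y a :
  hcomp V (c *: x + y) a = c *: hcomp V x a + hcomp V y a.
Proof.
have [[Vx finx xE] [Vy finy yE]] := (hcomp_decomposition x, hcomp_decomposition y).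
suff dP : is_decomposition V (c *: x + y)
    (fun a => c *: hcomp V x a + hcomp V y a).
  have [f [_ f_uniq]] := gV.2 (c *: x + y).
  by rewrite -(f_uniq _ (hcomp_decomposition _)) (f_uniq _ dP).
pose A := [set a | hcomp V x a != 0] `|` [set a | hcomp V y a != 0].
have finA : finite_set A by rewrite finite_setU.
have A0 b : ~ A b -> hcomp V x b = 0 /\ hcomp V y b = 0.
  by move=> /not_orP[/negP/negPn/eqP + /negP/negPn/eqP].
split=> [b||].
- exact: gradingP.
- apply: sub_finite_set finA => b /= nz; apply: contrapT => /A0[x0 y0].
  by move: nz; rewrite x0 y0 scaler0 addr0 eqxx.
- rewrite {1}xE {1}yE !(fsumE _ finA).
  + by rewrite scaler_sumr -big_split.
  all: by move=> b /A0[x0 y0]; rewrite ?x0 ?y0 ?scaler0 ?addr0.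
Qed.

Section Commutator.
Variables (eps : G -> G -> K) (m : {bilinear T -> T -> T}).

(** [A] and [B] may exceed the supports, so that several commutators can be summed over the same
    index sets. *)
Lemma color_commutator_bigE {A B : set G} x y :
  finite_set A -> finite_set B ->
  (forall a, ~ A a -> hcomp V x a = 0) -> (forall b, ~ B b -> hcomp V y b = 0) ->
  color_commutator V eps m x y =
  \sum_(a <- fset_set A) \sum_(b <- fset_set B)
    (m (hcomp V x a) (hcomp V y b) - eps a b *: m (hcomp V y b) (hcomp V x a)).
Proof.
move=> finA finB A0 B0; rewrite /color_commutator (fsumE _ finA) => [|a /A0 x0].
  apply: eq_bigr => a _; rewrite (fsumE _ finB)// => b /B0->.
  by rewrite linear0l linear0r scaler0 subr0.
by apply: fsbig1 => b _; rewrite x0 linear0l linear0r scaler0 subr0.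
Qed.

Lemma color_commutator_bilinear :
  bilinear_for *:%R *:%R (color_commutator V eps m).
Proof.
pose S x := [set a | hcomp V x a != 0].
have finS x : finite_set (S x) by case: (hcomp_decomposition x).
have S0 x a : ~ S x a -> hcomp V x a = 0 by move=> /negP/negPn/eqP.
have finU x y : finite_set (S x `|` S y) by rewrite finite_setU.
have U0l x y a : ~ (S x `|` S y) a -> hcomp V x a = 0.
  by move=> /not_orP[/S0].
have U0r x y a : ~ (S x `|` S y) a -> hcomp V y a = 0.
  by move=> /not_orP[_ /S0].
have U0P c x y a : ~ (S x `|` S y) a -> hcomp V (c *: x + y) a = 0.
  by move=> U0; rewrite hcompP (U0l _ _ _ U0) (U0r _ _ _ U0) scaler0 addr0.
split=> u c x y /=.
(* All three commutators are summed over [S x ∪ S y] in the varying argument, then compared term by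
   term. *)
- rewrite (color_commutator_bigE _ _ (finU x y) (finS u) (U0P c x y) (S0 u)).
  rewrite (color_commutator_bigE _ _ (finU x y) (finS u) (U0l x y) (S0 u)).
  rewrite (color_commutator_bigE _ _ (finU x y) (finS u) (U0r x y) (S0 u)).
  rewrite scaler_sumr -big_split; apply: eq_bigr => a _ /=.
  rewrite scaler_sumr -big_split; apply: eq_bigr => b _ /=.
  rewrite hcompP linearPl linearPr /= scalerBr scalerDr !scalerA mulrC.
  by rewrite opprD addrACA.
- rewrite (color_commutator_bigE _ _ (finS u) (finU x y) (S0 u) (U0P c x y)).
  rewrite (color_commutator_bigE _ _ (finS u) (finU x y) (S0 u) (U0l x y)).
  rewrite (color_commutator_bigE _ _ (finS u) (finU x y) (S0 u) (U0r x y)).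
  rewrite scaler_sumr -big_split; apply: eq_bigr => a _ /=.
  rewrite scaler_sumr -big_split; apply: eq_bigr => b _ /=.
  rewrite hcompP linearPl linearPr /= scalerBr scalerDr !scalerA mulrC.
  by rewrite opprD addrACA.
Qed.

Lemma color_commutator_homogE a b x y : x \in V a -> y \in V b ->
  color_commutator V eps m x y = m x y - eps a b *: m y x.
Proof.
apply: color_commutatorE => //; split=> u c v w /=; first exact: linearPl.
exact: linearPr.
Qed.

Lemma color_commutator_even : even_map2 V m ->
  even_map2 V (color_commutator V eps m).
Proof.
move=> mV a b x y Vx Vy; rewrite (color_commutator_homogE _ _ _ _ Vx Vy).
apply: gradingB; first exact: mV.
(* [m y x] has degree [b + a], equal to [a + b] as [G] is abelian. *)
by apply: gradingZ; rewrite addrC; exact: mV.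
Qed.

End Commutator.
End Grading.

(** * Scaling by bicharacter values *)

Lemma scaleAC {R : comNzRingType} {M : lmodType R} (c d : R) (x : M) :
  c *: (d *: x) = d *: (c *: x).
Proof. by rewrite !scalerA mulrC. Qed.

Section Bicharacter.
Context {K : fieldType} {G : zmodType} {T : lmodType K} (eps : G -> G -> K).
Hypothesis epsP : is_bicharacter eps.

Lemma bicharK a b : cancel ( *:%R (eps a b) : T -> T) ( *:%R (eps b a)).
Proof. by move=> x; rewrite scalerA bichar_skew// scale1r. Qed.

Lemma bicharZDl a b c (x : T) :
  eps (a + b) c *: x = eps a c *: (eps b c *: x).
Proof. by rewrite bicharDl// scalerA. Qed.

Lemma bicharZDr a b c (x : T) :
  eps a (b + c) *: x = eps a b *: (eps a c *: x).
Proof. by rewrite bicharDr// scalerA. Qed.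

End Bicharacter.

(** * The post-Lie identities *)

Section Tridendriform.
Context {K : fieldType} {G : zmodType} {T : lmodType K} (V : G -> {pred T}).
Variables (lt rt dt : {bilinear T -> T -> T}).
Variables (eps : G -> G -> K) (alpha : T -> T).
Hypothesis tri : is_hom_tridendriform_color V lt rt dt eps alpha.

Let gV := htd_grading tri.
Let epsP := htd_eps tri.
Let dtV : even_map2 V dt := (htd_dt tri).2.
Let alphaV : even_map V alpha := (htd_alpha tri).2.

Local Notation "x ⊣ y" := (lt x y) (at level 40, left associativity).
Local Notation "x ⊢ y" := (rt x y) (at level 40, left associativity).
Local Notation "x ⋅ y" := (dt x y) (at level 40, left associativity).
Local Notation "x ∘ y" := (flip_sub rt lt x y) (at level 40, left associativity).
Local Notation "⟦ x , y ⟧" := (color_commutator V eps dt x y)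
  (at level 0, x, y at level 99).

Lemma flip_sub_even : even_map2 V (flip_sub rt lt).
Proof.
move=> a b x y Vx Vy; apply: (gradingB _ gV); first exact: (htd_rt tri).2.
by rewrite addrC; exact: (htd_lt tri).2.
Qed.

Let circBr x y z : x ∘ (y - z) = x ∘ y - x ∘ z.
Proof. by rewrite /flip_sub linearBr linearBl /= !opprD !opprK addrACA. Qed.

Let circZr c x y : x ∘ (c *: y) = c *: (x ∘ y).
Proof. by rewrite /flip_sub linearZr_LR linearZl_LR /= scalerBr. Qed.

Section Homogeneous.
Variables (a b c : G) (x y z : T).
Hypotheses (Vx : x \in V a) (Vy : y \in V b) (Vz : z \in V c).

Let commE := color_commutator_homogE V gV eps dt.

Lemma color_commutator_skew : ⟦x, y⟧ = - (eps a b *: ⟦y, x⟧).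
Proof.
rewrite (commE _ _ _ _ Vx Vy) (commE _ _ _ _ Vy Vx) scalerBr bicharK//.
by rewrite opprB.
Qed.

(** Hom-associativity makes every term right-nested, so the three cyclic instances involve only six
    products, each occurring twice. *)
Lemma color_commutator_nested :
  ⟦alpha x, ⟦y, z⟧⟧ =
  alpha x ⋅ (y ⋅ z) - eps b c *: (alpha x ⋅ (z ⋅ y))
    - eps a b *: (eps a c *: (alpha y ⋅ (z ⋅ x)))
    + eps a b *: (eps a c *: (eps b c *: (alpha z ⋅ (y ⋅ x)))).
Proof.
have Vbr := color_commutator_even V gV eps dt dtV _ _ _ _ Vy Vz.
rewrite (commE _ _ _ _ (alphaV _ _ Vx) Vbr) (commE _ _ _ _ Vy Vz).
rewrite linearBr linearBl linearZr_LR linearZl_LR /=.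
rewrite (htd_dt_dt tri Vy Vz Vx) (htd_dt_dt tri Vz Vy Vx).
by rewrite bicharZDr// !scalerBr opprB addrA [_ + _ - _]addrAC -!addrA.
Qed.

Lemma flip_sub_dt :
  alpha z ∘ (x ⋅ y) = (z ∘ x) ⋅ alpha y + eps c a *: (alpha x ⋅ (z ∘ y)).
Proof.
rewrite /flip_sub linearBl linearBr /= scalerBr.
rewrite (htd_rt_dt tri Vz Vx Vy) (htd_dt_lt tri Vx Vy Vz).
(* The mixed terms [(x ⊣ z) ⋅ alpha y] and [alpha x ⋅ (z ⊢ y)] cancel. *)
by rewrite (htd_lt_dt tri Vx Vz Vy) addrA subrK.
Qed.

Let star a b x y := eps a b *: (x ⊣ y) + x ⊢ y + x ⋅ y.

(** The subtracted sum is unchanged by exchanging [y] with [z] and scaling by [eps c b], so it drops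
    out of the post-Lie identity and only the [star] terms remain. *)
Lemma flip_sub_nested :
  alpha z ∘ (y ∘ x) =
  star c b z y ⊢ alpha x + eps c b *: (alpha x ⊣ star b c y z)
    - (alpha z ⊢ (x ⊣ y) + eps c b *: (alpha y ⊢ (x ⊣ z))).
Proof.
rewrite /flip_sub linearBl linearBr /=.
rewrite (htd_rt_rt tri Vz Vy Vx) (htd_rt_lt tri Vy Vx Vz).
rewrite (htd_lt_lt tri Vx Vy Vz).
have -> : y ⊣ z + eps c b *: (y ⊢ z) + eps c b *: (y ⋅ z) =
    eps c b *: star b c y z by rewrite /star !scalerDr bicharK.
by rewrite linearZr_LR /= opprB addrACA -opprD.
Qed.

End Homogeneous.

Lemma color_commutator_jacobi a b c x y z :
  x \in V a -> y \in V b -> z \in V c ->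
  eps c a *: ⟦alpha x, ⟦y, z⟧⟧ + eps a b *: ⟦alpha y, ⟦z, x⟧⟧
    + eps b c *: ⟦alpha z, ⟦x, y⟧⟧ = 0.
Proof.
move=> Vx Vy Vz.
rewrite (color_commutator_nested _ _ _ _ _ _ Vx Vy Vz).
rewrite (color_commutator_nested _ _ _ _ _ _ Vy Vz Vx).
rewrite (color_commutator_nested _ _ _ _ _ _ Vz Vx Vy).
rewrite !(scalerDr, scalerN, bicharK)//.
(* Each commutation brings a scalar next to its inverse; the last one gives matching terms the same
   order of scalars. *)
rewrite !(scaleAC (eps c a) (eps a b)) !bicharK//.
rewrite !(scaleAC (eps a b) (eps b c)) !bicharK//.
rewrite !(scaleAC (eps b c) (eps c a)) !bicharK//.
rewrite !(scaleAC (eps c a) (eps a b)).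
zmod_cancel.
Qed.

Lemma flip_sub_derivation a b c x y z :
  x \in V a -> y \in V b -> z \in V c ->
  alpha z ∘ ⟦x, y⟧ - ⟦z ∘ x, alpha y⟧ - eps c a *: ⟦alpha x, z ∘ y⟧ = 0.
Proof.
move=> Vx Vy Vz; have commE := color_commutator_homogE V gV eps dt.
have [Vzx Vzy] := (flip_sub_even _ _ _ _ Vz Vx, flip_sub_even _ _ _ _ Vz Vy).
rewrite (commE _ _ _ _ Vx Vy) (commE _ _ _ _ Vzx (alphaV _ _ Vy)).
rewrite (commE _ _ _ _ (alphaV _ _ Vx) Vzy) circBr circZr.
rewrite (flip_sub_dt _ _ _ _ _ _ Vx Vy Vz) (flip_sub_dt _ _ _ _ _ _ Vy Vx Vz).
(* The scalars to split come from the degrees [c + a] of [z ∘ x] and [c + b] of [z ∘ y]. *)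
rewrite bicharZDl// bicharZDr// !(scalerDr, scalerN) bicharK//.
rewrite (scaleAC (eps a b) (eps c b)).
zmod_cancel.
Qed.

Lemma flip_sub_post_lie a b c x y z :
  x \in V a -> y \in V b -> z \in V c ->
  alpha z ∘ (y ∘ x) - eps c b *: (alpha y ∘ (z ∘ x))
    + eps c b *: ((y ∘ z) ∘ alpha x) - (z ∘ y) ∘ alpha x
    + eps c b *: (⟦y, z⟧ ∘ alpha x) = 0.
Proof.
move=> Vx Vy Vz; rewrite (color_commutator_homogE V gV _ _ _ _ _ _ Vy Vz).
rewrite (flip_sub_nested _ _ _ _ _ _ Vx Vy Vz).
rewrite (flip_sub_nested _ _ _ _ _ _ Vx Vz Vy) /flip_sub.
rewrite !(linearDl, linearDr, linearNl, linearNr, linearZl_LR, linearZr_LR) /=.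
rewrite !(scalerDr, scalerN, opprD, opprK, bicharK)//.
zmod_cancel.
Qed.


End Tridendriform.
Theorem theorem3p19 (K : fieldType) (char_K : 2%N \notin [pchar K])
    (G : zmodType) (T : lmodType K) (V : G -> {pred T})
    (ldash rdash dot : T -> T -> T) (eps : G -> G -> K) (alpha : T -> T) :
  is_hom_tridendriform_color V ldash rdash dot eps alpha ->
  is_hom_post_lie_color V
    (color_commutator V eps dot) (fun x y => rdash x y - ldash y x)
    eps alpha.

Proof.
move=> tri.
have [lt ltE] := bilinear_pack ldash (htd_lt tri).1.
have [rt rtE] := bilinear_pack rdash (htd_rt tri).1.
have [dt dtE] := bilinear_pack dot (htd_dt tri).1.
subst ldash rdash dot; have gV := htd_grading tri.
split.
- exact: gV.
- exact: htd_eps tri.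
- exact: htd_alpha tri.
- split; first exact: color_commutator_bilinear.
  exact: color_commutator_even gV _ _ (htd_dt tri).2.
- split; [exact: flip_sub_bilinear | exact: flip_sub_even tri].
- exact: color_commutator_skew tri.
- exact: color_commutator_jacobi tri.
- exact: flip_sub_derivation tri.
- exact: flip_sub_post_lie tri.
Qed.
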